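(* There exists an absolute constant $C>0$ such that for all integers $\Delta\ge 2$ and $\omega\ge 2$, every graph $G$ of maximum degree at most $\Delta$ with no clique of size greater than $\omega$ satisfies \[ \chi_\ell(G)\le C\,\Delta\sqrt{\frac{\ln(\omega)}{\ln(\Delta)}}. \]
   Context: $\chi_\ell(G)$ denotes the list-chromatic number (choice number) of $G$: the least $k$ such that $G$ has a proper coloring from the lists $L(v)$ for every assignment of lists $L$ with $|L(v)|\ge k$ for all $v$. *)

(* Defs.v *)
From HB Require Import structures.
From mathcomp Require Import all_boot all_order all_algebra.
From mathcomp Require Import all_classical all_reals all_analysis.

Set Implicit Arguments.
Unset Strict Implicit.
Unset Printing Implicit Defensive.

Record sgraph := SGraph {
  vertex :> finType;
  adj : rel vertex;
  adj_sym : symmetric adj;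
  adj_irrefl : irreflexive adj
}.

Definition max_degree (G : sgraph) : nat :=
  \max_(v : G) #|[set u : G | adj v u]|.

Definition is_clique (G : sgraph) (A : {set G}) : Prop :=
  {in A &, forall u v, u != v -> adj u v}.

Definition proper_coloring (G : sgraph) (K : Type) (f : G -> K) : Prop :=
  forall u v : G, adj u v -> f u <> f v.

(* A finite graph with finite lists uses finitely many colors in total, so the
   palette K is taken to be a finite type. *)
Definition choosable (G : sgraph) (k : nat) : Prop :=
  forall (K : finType) (L : G -> {set K}),
    (forall v, k <= #|L v|) ->
    exists f : G -> K, (forall v, f v \in L v) /\ proper_coloring f.

Lemma choosable_card (G : sgraph) : choosable G #|G|.
Proof.
move=> K L hL.
have L0 v : exists x, x \in L v.
  by apply/card_gt0P; apply: leq_trans (hL v); apply/card_gt0P; exists v.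
have [f0 hf0] := boolp.choice L0.
suff [f fL fI] : exists2 f : G -> K, (forall v, f v \in L v) &
    {in enum G &, injective f}.
  exists f; split=> // u v uv fuv.
  have uE : u = v by apply: fI => //; rewrite mem_enum.
  by rewrite uE adj_irrefl in uv.
have := enum_uniq G; have := leqnn (size (enum G)).
rewrite -[X in _ <= X]cardE.
elim: (enum G) => [|a s IHs] /= szs; first by exists f0.
move=> /andP[as' us]; have [f fL fI] := IHs (ltnW szs) us.
have /card_gt0P[x] : 0 < #|L a :\: [set f v | v in s]|.
  rewrite cardsD subn_gt0; apply: leq_trans (hL a).
  apply: leq_ltn_trans (subset_leq_card (subsetIr _ _)) _.
  apply: leq_ltn_trans (leq_imset_card _ _) _.
  by apply: leq_ltn_trans szs; apply: card_size.
rewrite inE => /andP[xs xL].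
have xNf v : v \in s -> x <> f v.
  by move=> vs xE; move/imsetP: xs; apply; exists v.
exists (fun v => if v == a then x else f v) => [v|u v].
  by case: eqP => [->|].
rewrite !inE; case: (eqVneq u a) => [->|ua]; case: (eqVneq v a) => [->|va] //=.
- by move=> _ vs /(xNf _ vs).
- by move=> us' _ /esym /(xNf _ us').
- exact: fI.
Qed.

Lemma ex_choosable (G : sgraph) : exists k, `[< choosable G k >].
Proof. by exists #|G|; apply/asboolP; exact: choosable_card. Qed.

Definition list_chromatic_number (G : sgraph) : nat := ex_minn (ex_choosable G).

(* Main.v *)
(** Consider all proper partial colourings from the lists, uniformly weighted, and fix the
colouring outside the neighbourhood [N(v)].  For each colour [c], conditionally on everything
else, the set of neighbours of [v] coloured [c] is a uniform independent subset of some [W]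
inside [N(v)].  Since cliques have size at most [omega], a Ramsey-type count shows that, up to
[M = (4 omega) ^ (5 b^2)] exceptions, at most half of the independent subsets of [W] have fewer
than [b] elements.  So either [c] is unused with probability of order [1 / M], or it is used
[b] times or more with probability about one half; the latter can happen for at most
[Delta / b] colours.  With lists of size [8 Delta / b], except with tiny probability, [v] then
keeps at least [2 t] available colours, where [t] is about [Delta / (2 M^2)].  A vertex with
that many available colours is blank with probability about [1 / (2 t)], so with overwhelming
probability fewer than [t] such neighbours of [v] are blank.  The lopsided local lemma yields a
partial colouring good at every vertex, and it extends greedily.  Taking [b] of order
[sqrt (ln Delta / ln omega)] makes [M] a small power of [Delta]. *)
Require Import Defs.
From HB Require Import structures.
From mathcomp Require Import all_classical all_reals all_analysis.
From mathcomp Require Import all_boot all_order all_algebra.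
From mathcomp Require Import zify ring lra.

Set Implicit Arguments.
Unset Strict Implicit.
Unset Printing Implicit Defensive.
Import Order.TTheory GRing.Theory Num.Theory.

Lemma card_bigcup_le (I T : finType) (P : pred I) (F : I -> {set T}) :
  #|\bigcup_(i | P i) F i| <= \sum_(i | P i) #|F i|.
Proof.
elim/big_rec2: _ => [|i n A _ leAn]; first by rewrite cards0.
by apply: leq_trans (leq_card_setU _ _) _; rewrite leq_add2l.
Qed.

Lemma sum_card_fiber_le (A B : finType) (D : {set A}) (P : {set B}) (h : A -> B) :
  \sum_(y in P) #|[set x in D | h x == y]| <= #|D|.
Proof.
rewrite -[leqRHS]sum1_card (partition_big h predT) //= [leqRHS](bigID (mem P)) /=.
rewrite -[leqLHS]addn0 leq_add //; apply: leq_sum => y _.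
by rewrite -sum1_card; apply: eq_leq; apply: eq_bigl => x; rewrite inE.
Qed.

Lemma sum_bool_card (T : finType) (A : {set T}) (P : pred T) :
  \sum_(x in A) P x = #|[set x in A | P x]|.
Proof. by rewrite -sum1dep_card big_mkcondr. Qed.

Lemma leq_wexp2r (m n e : nat) : m <= n -> m ^ e <= n ^ e.
Proof. by case: e => // e le_mn; rewrite leq_exp2r. Qed.

Lemma card_small_subsets_le (T : finType) (W : {set T}) (b : nat) :
  #|[set X : {set T} | (X \subset W) && (#|X| <= b)]| <= #|W|.+1 ^ b.
Proof.
elim: b => [|b].
  rewrite expn0 -(cards1 (@set0 T)); apply/subset_leq_card/subsetP => X.
  by rewrite !inE leqn0 cards_eq0 => /andP[].
set S := [set X : {set T} | _] => IHb; set S' := [set X : {set T} | _].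
have sub : S' \subset S :|: \bigcup_(a in W) [set a |: X | X in S].
  apply/subsetP => X; rewrite !inE => /andP[sXW Xb]; rewrite sXW /=.
  case: leqP => //= bX; have /card_gt0P[a aX] : 0 < #|X| by apply: leq_ltn_trans bX.
  apply/bigcupP; exists a; first exact: (subsetP sXW).
  apply/imsetP; exists (X :\ a); last by rewrite setD1K.
  by rewrite inE (subset_trans (subsetDl _ _)) //=; move: Xb; rewrite (cardsD1 a) aX.
apply: leq_trans (subset_leq_card sub) _.
apply: leq_trans (leq_card_setU _ _) _; rewrite expnS mulSn leq_add //.
apply: leq_trans (card_bigcup_le _ _) _.
apply: leq_trans (leq_sum _ (fun a _ => leq_imset_card (setU [set a]) S)) _.
by rewrite sum_nat_const leq_mul.
Qed.

Lemma expn_le_sqr_fact n : n ^ n <= n`! ^ 2.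
Proof.
rewrite fact_prod big_add1 /= big_mkord -mulnn.
rewrite [X in _ * X](reindex_inj rev_ord_inj) -big_split /=.
rewrite -[X in _ ^ X <= _](card_ord n) -prod_nat_const.
by apply: leq_prod => i _; have := ltn_ord i; nia.
Qed.

Lemma ffact_le_expn n m : n ^_ m <= n ^ m.
Proof.
rewrite ffact_prod -[X in _ <= _ ^ X](card_ord m) -prod_nat_const.
by apply: leq_prod => i _; exact: leq_subr.
Qed.

Lemma sqr_bin_mul_le n m : 'C(n, m) ^ 2 * m ^ m <= n ^ (2 * m).
Proof.
apply: leq_trans (leq_mul (leqnn _) (expn_le_sqr_fact m)) _.
by rewrite -expnMn bin_ffact mulnC expnM leq_wexp2r // ffact_le_expn.
Qed.

Lemma bin_mul_expn4_le Delta t : 4 <= Delta -> 36 <= t -> Delta ^ 3 <= t ^ 4 ->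
  'C(Delta, t) * (2 * Delta ^ 4) <= t ^ t.
Proof.
move=> Delta_ge4 t_ge36 le_t.
have Delta_le : 2 ^ 2 * Delta ^ (4 * 2) <= Delta ^ 9 by rewrite [leqRHS]expnS leq_mul.
have exp_le : Delta ^ (2 * t + 9) <= (t ^ t) ^ 3.
  rewrite -(@leq_exp2r _ _ 4) // -expnM.
  apply: leq_trans (_ : Delta ^ (3 * (3 * t)) <= _); first by rewrite leq_exp2l; lia.
  rewrite expnM (_ : ((t ^ t) ^ 3) ^ 4 = (t ^ 4) ^ (3 * t)) ?leq_wexp2r //.
  by rewrite -!expnM; congr (_ ^ _); lia.
rewrite -(@leq_exp2r _ _ 2) // -(leq_pmul2r (_ : 0 < t ^ t)); last by rewrite expn_gt0; lia.
rewrite -expnSr; apply: leq_trans exp_le; rewrite expnMn (expnMn 2).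
rewrite -(expnM Delta) mulnAC expnD.
by rewrite leq_mul // sqr_bin_mul_le.
Qed.

Lemma expn8_le_exp2 n : 48 <= n -> n ^ 8 <= 2 ^ n.
Proof.
have lin m : 6 <= m -> 8 * m.+1 <= 2 ^ m.
  elim: m => // m IHm; rewrite leq_eqVlt => /predU1P[<- //|/IHm].
  by rewrite [2 ^ m.+1]expnS; lia.
move=> n_ge48; have /lin le_8th : 6 <= n %/ 8 by rewrite leq_divRL.
apply: leq_trans (_ : (2 ^ (n %/ 8)) ^ 8 <= _); last by rewrite -expnM leq_exp2l // leq_divM.
by rewrite leq_wexp2r // (leq_trans _ le_8th) // mulnC ltnW // ltn_ceil.
Qed.

Lemma cube_le_expn4_div Delta M : 4 <= M -> M ^ 20 <= Delta ->
  Delta ^ 3 <= (Delta %/ (2 * M ^ 2)) ^ 4.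
Proof.
move=> M_ge4 le_Delta; set t := Delta %/ _.
have M_gt0 : 0 < M by lia.
have Delta_lt : Delta < t.+1 * (2 * M ^ 2) by rewrite ltn_ceil // muln_gt0 expn_gt0 M_gt0.
have t_gt0 : 0 < t.
  rewrite divn_gt0 ?muln_gt0 ?expn_gt0 ?M_gt0 //; apply: leq_trans le_Delta.
  apply: leq_trans (_ : M ^ 3 <= _); last by rewrite leq_exp2l // ltnW // ltnW.
  by rewrite [leqRHS]expnS leq_mul //; lia.
have Delta_le : Delta <= t * M ^ 3.
  apply: leq_trans (ltnW Delta_lt) _; rewrite (expnS M 2) !(mulnA _ _ (M ^ 2)) leq_mul //.
  apply: leq_trans (leq_mul (leqnn t) M_ge4); rewrite -[4]/(2 * 2) mulnA leq_mul //.
  by rewrite muln2 -addnn -addn1 leq_add2l.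
have Delta_gt0 : 0 < Delta by apply: leq_trans le_Delta; rewrite expn_gt0 M_gt0.
rewrite -(leq_pmul2r Delta_gt0) -expnSr; apply: leq_trans (leq_wexp2r 4 Delta_le) _.
rewrite expnMn leq_mul // (leq_trans _ le_Delta) // -expnM leq_exp2l //.
exact: leq_trans M_ge4.
Qed.

Lemma ex_leq_ltn_succ (f : nat -> nat) n : f 0 <= n -> (forall m, m <= f m) ->
  exists m, f m <= n < f m.+1.
Proof.
move=> f0_le f_ge; have f_le_n m : f m <= n -> m <= n := leq_trans (f_ge m).
case: (ex_maxnP (ex_intro (fun m => f m <= n) 0 f0_le) f_le_n) => m fm_le max_m.
by exists m; rewrite fm_le ltnNge; apply/negP => /max_m; rewrite ltnn.
Qed.

Lemma ex_max_sqr_exponent q c n : 1 < q -> 0 < c -> 0 < n ->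
  exists b, q ^ (c * b ^ 2) <= n < q ^ (c * b.+1 ^ 2).
Proof.
move=> q_gt1 c_gt0 n_gt0; apply: (ex_leq_ltn_succ (f := fun b => q ^ (c * b ^ 2))).
  by rewrite muln0.
move=> b; apply: leq_trans (ltnW (ltn_expl b q_gt1)) _; rewrite leq_exp2l // -mulnn.
by case: b => // b; rewrite mulnA leq_pmull // muln_gt0 c_gt0.
Qed.

Section RealEstimates.
Local Open Scope ring_scope.

Lemma exprn_one_sub_mul_le1 (F : realFieldType) (x : F) n : 0 <= x <= 1 ->
  (1 - x) ^+ n * (1 + n%:R * x) <= 1.
Proof.
case/andP=> x_ge0 x_le1; elim: n => [|n IHn]; first by rewrite expr0 mul0r addr0 mulr1.
rewrite exprSr -mulrA; apply: le_trans IHn; apply: ler_wpM2l.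
  by rewrite exprn_ge0 // subr_ge0.
rewrite -natr1; have : 0 <= n%:R * x * x by rewrite !mulr_ge0.
nra.
Qed.

Lemma exprn_one_sub_inv_le_half (F : realFieldType) n : (0 < n)%N ->
  (1 - n%:R^-1) ^+ n <= 2^-1 :> F.
Proof.
move=> n_gt0; have inv_itv : 0 <= (n%:R^-1 : F) <= 1.
  by rewrite invr_ge0 ler0n invf_le1 ?ltr0n // ler1n.
have := exprn_one_sub_mul_le1 n inv_itv; rewrite mulfV ?pnatr_eq0 -?lt0n //.
by rewrite -[1 + 1]/(2 : F) -ler_pdivlMr // div1r.
Qed.

Lemma exprn_one_sub_inv_double_le (F : realFieldType) (k t h M : nat) : (1 < M)%N ->
  (16 * M * t <= k)%N -> (8 * h <= k)%N ->
  (1 - (2 * M%:R)^-1) ^+ k <= 2^-1 ^+ (4 * t) * (1 - M%:R^-1) ^+ h :> F.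
Proof.
move=> M_gt1 t_le h_le; have M_ge2 : 2 <= M%:R :> F by rewrite ler_nat.
set y := (2 * M%:R)^-1.
have y_ge0 : 0 <= y by rewrite invr_ge0; lra.
have y_le : y <= 4^-1 by rewrite lef_pV2 ?posrE; lra.
have invM : M%:R^-1 = 2 * y by rewrite /y; field; lra.
have r_ge0 : 0 <= 1 - y by lra.
have quartic : (1 - y) ^+ 4 <= 1 - M%:R^-1 by rewrite invM !exprS expr0; nra.
have half : (1 - y) ^+ (2 * M) <= 2^-1.
  by rewrite /y -natrM exprn_one_sub_inv_le_half // muln_gt0 /= ltnW.
apply: (@le_trans _ _ ((1 - y) ^+ (2 * M * (4 * t) + 4 * h))).
  by apply: ler_wiXn2l; rewrite ?gerBl //; clear -t_le h_le; lia.
rewrite exprD (exprM _ (2 * M)%N) (exprM _ 4 h); apply: ler_pM; rewrite ?exprn_ge0 //.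
  by apply: lerXn2r; rewrite ?nnegrE ?exprn_ge0 ?invr_ge0.
by apply: lerXn2r; rewrite ?nnegrE ?exprn_ge0 // (le_trans _ quartic) ?exprn_ge0.
Qed.

Lemma expn4_mul_exprn_one_sub_inv_double_le (F : realFieldType) (Delta k t h M : nat) :
  (1 < M)%N -> (16 * M * t <= k)%N -> (8 * h <= k)%N ->
  (0 < t)%N -> (Delta ^ 4 <= 2 ^ t)%N ->
  (2 * Delta ^ 4)%:R * (1 - (2 * M%:R)^-1) ^+ k
    <= 2^-1 ^+ (2 * t) * (1 - M%:R^-1) ^+ h :> F.
Proof.
move=> M_gt1 t_le h_le t_gt0 Delta_le.
apply: le_trans (ler_wpM2l (ler0n _ _) (exprn_one_sub_inv_double_le _ M_gt1 t_le h_le)) _.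
have base_ge0 : 0 <= 1 - M%:R^-1 :> F.
  by rewrite subr_ge0 invf_le1 ?ltr0n ?ler1n // ltnW.
rewrite mulrA; apply: ler_wpM2r; first exact: exprn_ge0.
rewrite -{2}[4%N]/(2 * 2)%N -mulnA [(2 * (2 * t))%N]mulSn mul1n exprD mulrA -[leRHS]mul1r.
apply: ler_wpM2r; first by rewrite exprn_ge0 ?invr_ge0.
rewrite exprVn ler_pdivrMr ?exprn_gt0 // mul1r -natrX ler_nat (mul2n t) -addnn expnD.
by rewrite leq_mul // -[leqLHS]expn1 leq_exp2l.
Qed.

Lemma le1_mul_sqrt_div (F : rcfType) (m x y : F) :
  0 <= m -> 0 < y -> y <= m ^+ 2 * x -> 1 <= m * Num.sqrt (x / y).
Proof.
move=> m_ge0 y_gt0 y_le; rewrite -{1}(sqrtr1 F) -{1}(ger0_norm m_ge0) -sqrtr_sqr.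
by rewrite -sqrtrM ?sqr_ge0 // ler_wsqrtr // mulrA ler_pdivlMr // mul1r.
Qed.

Lemma ln_natr_le (R : realType) (m n k : nat) : (0 < m)%N -> (0 < n)%N ->
  (m <= n ^ k)%N -> ln (m%:R : R) <= k%:R * ln (n%:R : R).
Proof.
move=> m_gt0 n_gt0 le_m; rewrite mulr_natl -lnXn ?ltr0n // -natrX.
by rewrite ler_ln ?posrE ?ltr0n ?expn_gt0 ?n_gt0 // ler_nat.
Qed.

End RealEstimates.

Section LopsidedLocalLemma.
Variables (A I : finType) (D : {set A}) (bad : I -> pred A).
Implicit Types (S U : {set I}) (f : A) (u v : I).

Definition avoiding S := [set f in D | [forall u in S, ~~ bad u f]].

Lemma avoidingS S U : S \subset U -> avoiding U \subset avoiding S.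
Proof.
move=> sSU; apply/subsetP => f; rewrite !inE => /andP[-> /forall_inP goodU] /=.
by apply/forall_inP => u /(subsetP sSU)/goodU.
Qed.

Lemma card_avoiding_setU S U :
  #|avoiding S| <= #|avoiding (S :|: U)| + \sum_(u in U) #|[set f in avoiding S | bad u f]|.
Proof.
apply: leq_trans (leq_add (leqnn _) (card_bigcup_le _ _)).
apply: leq_trans (leq_card_setU _ _); apply/subset_leq_card/subsetP => f goodf.
rewrite in_setU; case: (boolP [exists u in U, bad u f]) => [/exists_inP[u uU badf]|].
  by apply/orP; right; apply/bigcupP; exists u; rewrite // inE goodf.
move=> /exists_inPn goodU; move: goodf; rewrite !inE => /andP[-> /forall_inP goodS].
by apply/orP; left; apply/forall_inP => u /setUP[/goodS|/goodU].
Qed.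

(* For the uniform distribution on [D], [bad_far] bounds the probability of [bad v],
   conditionally on avoiding any set of far away bad events, by [1 / N]. *)
Variables (near : rel I) (d N : nat).
Hypothesis bad_far : forall v S, {in S, forall u, ~~ near v u} ->
  N * #|[set f in avoiding S | bad v f]| <= #|avoiding S|.
Hypothesis near_le : forall v, #|[set u | near v u]| <= d.
Hypothesis d_le : 4 * d <= N.

Lemma bad_rare v S : N * #|[set f in avoiding S | bad v f]| <= 2 * #|avoiding S|.
Proof.
have [m] := ubnP #|S|; elim: m v S => // m IHm v S cardS.
set close := [set u in S | near v u]; pose far := S :\: close.
have farN : {in far, forall u, ~~ near v u}.
  by move=> u; rewrite !inE => /andP[]; case: (u \in S).
have closeS : close \subset S by apply/subsetP => u; rewrite inE => /andP[].
have farUclose : far :|: close = S.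
  by apply/setP => u; rewrite !inE; case: (u \in S) => //=; case: near.
have rare_far : N * #|[set f in avoiding S | bad v f]| <= #|avoiding far|.
  apply: leq_trans (bad_far farN); rewrite leq_mul //; apply/subset_leq_card.
  by rewrite !setIdE setSI // avoidingS // subsetDl.
apply: leq_trans rare_far _; have [close0|close_gt0] := posnP #|close|.
  by rewrite -farUclose (cards0_eq close0) setU0 leq_pmull.
have farS : #|far| < #|S|.
  rewrite cardsD (setIidPr closeS) ltn_subrL close_gt0.
  by rewrite (leq_trans close_gt0) ?subset_leq_card.
have close_le : #|close| <= d.
  by apply: leq_trans (near_le v); apply/subset_leq_card/subsetP => u; rewrite !inE => /andP[].
have sum_le : N * \sum_(u in close) #|[set f in avoiding far | bad u f]|
    <= #|close| * (2 * #|avoiding far|).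
  rewrite big_distrr -sum_nat_const /=; apply: leq_sum => u _; apply: IHm.
  by apply: leq_trans farS _.
have := card_avoiding_setU far close; rewrite farUclose; nia.
Qed.

Hypothesis N_gt2 : 2 < N.
Hypothesis D_gt0 : 0 < #|D|.

Lemma avoiding_gt0 S : 0 < #|avoiding S|.
Proof.
have [m] := ubnP #|S|; elim: m S => // m IHm S cardS.
have [->|[v vS]] := set_0Vmem S.
  apply: leq_trans D_gt0 _; apply/subset_leq_card/subsetP => f fD.
  by rewrite inE fD; apply/forall_inP => u; rewrite inE.
have avoid_gt0 : 0 < #|avoiding (S :\ v)|.
  by apply: IHm; move: cardS; rewrite (cardsD1 v) vS.
have := card_avoiding_setU (S :\ v) [set v]; rewrite big_set1 setUC setD1K //.
have := bad_rare v (S :\ v); nia.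
Qed.

Lemma lopsided_local_lemma : exists2 f, f \in D & forall v, ~~ bad v f.
Proof.
have /card_gt0P[f] := avoiding_gt0 [set: I].
rewrite inE => /andP[fD /forall_inP good]; exists f => // v.
by apply: good; rewrite inE.
Qed.

End LopsidedLocalLemma.

Section IndependentSets.
Variable G : sgraph.
Implicit Types (A V W X : {set G}) (a u v : G) (b s : nat).

Definition independent X := [forall x in X, forall y in X, ~~ adj x y].

Definition indep_sets W := [set X : {set G} | (X \subset W) && independent X].

Definition indep_sets_of_card W s := [set X in indep_sets W | #|X| == s].

Definition nonneighbors W a := [set u in W | (u != a) && ~~ adj a u].

Lemma independentP X : reflect {in X &, forall x y, ~~ adj x y} (independent X).
Proof.
apply: (iffP forall_inP) => [indX x y xX yX|indX x xX].
  by have /forall_inP := indX x xX; apply.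
by apply/forall_inP => y yX; exact: indX.
Qed.

Lemma independent0 : independent set0.
Proof. by apply/independentP => x y; rewrite inE. Qed.

Lemma independent1 a : independent [set a].
Proof. by apply/independentP => x y /set1P-> /set1P->; rewrite adj_irrefl. Qed.

Lemma set0_indep_sets W : set0 \in indep_sets W.
Proof. by rewrite inE sub0set independent0. Qed.

Lemma independentU1 a X :
  independent X -> {in X, forall u, ~~ adj a u} -> independent (a |: X).
Proof.
move=> /independentP indX aX; apply/independentP => x y.
rewrite !inE => /predU1P[->|xX] /predU1P[->|yX]; rewrite ?adj_irrefl ?aX //.
  by rewrite adj_sym aX.
exact: indX.
Qed.

Lemma nonneighborsS V W a : V \subset W -> nonneighbors V a \subset nonneighbors W a.
Proof. by move=> sVW; apply/subsetP => u; rewrite !inE => /andP[/(subsetP sVW)->]. Qed.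

Lemma notin_sub_nonneighbors W X a : X \subset nonneighbors W a -> a \notin X.
Proof. by move=> sX; apply/negP => /(subsetP sX); rewrite !inE eqxx andbF. Qed.

Lemma exists_clique_nonneighbors_cover W :
  exists2 A, is_clique A & A \subset W /\ W \subset \bigcup_(a in A) (a |: nonneighbors W a).
Proof.
pose P A := (A \subset W) && `[< is_clique A >].
have P0 : P set0 by rewrite /P sub0set; apply/asboolP => x y; rewrite inE.
have [A /maxsetP[/andP[sAW /asboolP clA] maxA]] := ex_maxset (ex_intro P set0 P0).
exists A => //; split=> //; apply/subsetP => u uW; apply/bigcupP.
case: (boolP [exists a in A, ~~ adj a u]) => [/exists_inP[a aA Nau]|/exists_inPn Au].
  by exists a => //; rewrite !inE uW Nau andbT /=; case: eqP.
exists u; last by rewrite !inE eqxx.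
have adjAu a : a \in A -> adj a u by move=> /Au; rewrite negbK.
rewrite -(maxA (u |: A)) ?setU11 ?subsetUr // /P subUset sub1set uW sAW /=.
apply/asboolP => x y; rewrite !inE => /predU1P[->|xA] /predU1P[->|yA] //.
- by rewrite eqxx.
- by move=> _; rewrite adj_sym adjAu.
- by move=> _; exact: adjAu.
- exact: clA.
Qed.

Lemma card_indep_sets_nonneighbors W a s : a \in W ->
  #|indep_sets_of_card (nonneighbors W a) s|
    <= #|[set X in indep_sets_of_card W s.+1 | a \in X]|.
Proof.
move=> aW; rewrite -(card_in_imset (f := setU [set a])); last first.
  move=> X Y; rewrite !inE => /andP[/andP[/notin_sub_nonneighbors aX _] _].
  move=> /andP[/andP[/notin_sub_nonneighbors aY _] _] eqXY.
  by rewrite -(setU1K aX) eqXY setU1K.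
apply/subset_leq_card/subsetP => _ /imsetP[X /[!inE] /andP[/andP[sX indX] /eqP cardX] ->].
rewrite setU11 andbT subUset sub1set aW cardsU1 (notin_sub_nonneighbors sX) cardX eqxx.
rewrite (subset_trans sX) ?andbT /=; last by apply/subsetP => u; rewrite inE => /andP[].
by apply: independentU1 => // u /(subsetP sX); rewrite !inE => /and3P[].
Qed.

Lemma sum_card_indep_sets_nonneighbors W s :
  \sum_(a in W) #|indep_sets_of_card (nonneighbors W a) s|
    <= s.+1 * #|indep_sets_of_card W s.+1|.
Proof.
set Is := indep_sets_of_card W s.+1.
apply: leq_trans (leq_sum _ (fun a => @card_indep_sets_nonneighbors W a s)) _.
rewrite (eq_bigr (fun a => \sum_(X in Is | a \in X) 1)); last first.
  by move=> a _; rewrite -sum1_card; apply: eq_bigl => X; rewrite inE.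
rewrite (exchange_big_dep (mem Is)) /=; last by move=> a X _ /andP[].
rewrite mulnC -sum_nat_const; apply: leq_sum => X.
rewrite inE => /andP[_ /eqP <-]; rewrite sum1_card.
by apply/subset_leq_card/subsetP => a /andP[_ /andP[]].
Qed.

Definition few_small_indep_sets M b := forall W,
  #|[set X in indep_sets W | #|X| < b]| <= M + #|[set X in indep_sets W | b <= #|X|]|.

Section BoundedCliques.
Variable w : nat.
Hypothesis clique_le : forall A : {set G}, is_clique A -> #|A| <= w.

Lemma exists_many_nonneighbors W : W != set0 ->
  exists2 a, a \in W & #|W| <= w * #|nonneighbors W a|.+1.
Proof.
have [A clA [sAW coverW]] := exists_clique_nonneighbors_cover W.
case/set0Pn=> x /(subsetP coverW)/bigcupP[a0 a0A _].
case: (arg_maxnP (fun a => #|nonneighbors W a|) a0A) => a aA maxa.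
exists a; first exact: (subsetP sAW).
apply: leq_trans (subset_leq_card coverW) _; apply: leq_trans (card_bigcup_le _ _) _.
apply: leq_trans (_ : \sum_(u in A) #|nonneighbors W a|.+1 <= _); last first.
  by rewrite sum_nat_const leq_mul // clique_le.
apply: leq_sum => u uA; rewrite cardsU1.
by apply: leq_trans (leq_add (leq_b1 _) (maxa u uA)) _; rewrite add1n.
Qed.

Lemma half_has_many_nonneighbors W : 4 * w <= #|W| ->
  #|W| <= 2 * #|[set a in W | #|W| <= 4 * w * #|nonneighbors W a|]|.
Proof.
set rich := [set a in W | _] => wW.
have cardW : #|rich| + #|W :\: rich| = #|W|.
  by rewrite -(cardsID rich W) (setIidPr _) //; apply/subsetP => a /[!inE] /andP[].
suff : 2 * #|W :\: rich| <= #|W| by lia.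
have [->|/exists_many_nonneighbors[a]] := eqVneq (W :\: rich) set0.
  by rewrite cards0.
rewrite !inE negb_and -ltnNge => /andP[/orP[/negP//|poor] aW] le_poor.
have := subset_leq_card (nonneighborsS a (subsetDl W rich)).
move: poor; move: #|nonneighbors W a| => m; case: m => [|m]; nia.
Qed.
Hypothesis w_gt0 : 0 < w.

(* Choosing the vertices one at a time: half of the vertices of [W] have at least
   [#|W| / (4 w)] non-neighbours in [W], among which the remaining [s] are chosen. *)
Lemma card_indep_sets_of_card_ge s W : (4 * w) ^ s <= #|W| ->
  #|W| ^ s <= (4 * w) ^ (s ^ 2) * #|indep_sets_of_card W s|.
Proof.
elim: s W => [|s IHs] W largeW.
  by rewrite !expn0 mul1n; apply/card_gt0P; exists set0; rewrite inE set0_indep_sets cards0.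
have wW : 4 * w <= #|W|.
  by apply: leq_trans largeW; rewrite expnS leq_pmulr // expn_gt0 muln_gt0 w_gt0.
have := half_has_many_nonneighbors wW.
set q := 4 * w in IHs largeW *; set n := #|W| in largeW *.
set rich := [set a in W | _] => le_rich.
have q_gt0 : 0 < q by rewrite muln_gt0 w_gt0.
have extend a : a \in rich ->
    n ^ s <= q ^ (s ^ 2 + s) * #|indep_sets_of_card (nonneighbors W a) s|.
  rewrite inE => /andP[_ le_n].
  have le_qs : q ^ s <= #|nonneighbors W a|.
    by rewrite -(leq_pmul2l q_gt0) -expnS (leq_trans largeW).
  apply: leq_trans (leq_wexp2r s le_n) _.
  by rewrite expnMn addnC expnD -mulnA leq_mul // IHs.
have rich_sum : #|rich| * n ^ s <= q ^ (s ^ 2 + s) * (s.+1 * #|indep_sets_of_card W s.+1|).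
  rewrite -sum_nat_const; apply: leq_trans (leq_sum _ extend) _.
  rewrite -big_distrr leq_mul //= (leq_trans _ (sum_card_indep_sets_nonneighbors W s)) //.
  rewrite [leqRHS](big_setID rich) /= (setIidPr _) ?leq_addr //.
  by apply/subsetP => a; rewrite inE => /andP[].
have s_lt : 2 * s.+1 <= q ^ s.+1.
  apply: leq_trans (_ : 4 ^ s.+1 <= _); last by rewrite leq_wexp2r // leq_pmulr.
  by rewrite (expnMn 2 2) leq_mul ?(ltnW (ltn_expl _ _)) // expnS leq_pmulr ?expn_gt0.
rewrite expnS; apply: leq_trans (leq_mul le_rich (leqnn _)) _.
rewrite -mulnA; apply: leq_trans (leq_mul (leqnn 2) rich_sum) _.
have -> : s.+1 ^ 2 = s ^ 2 + s + s.+1 by rewrite -!mulnn mulSn mulnS; lia.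
by rewrite [q ^ (_ + s.+1)]expnD mulnCA -[leqRHS]mulnA leq_mul // mulnA leq_mul.
Qed.

Lemma few_small_indep_sets_bounded_cliques b :
  few_small_indep_sets ((4 * w) ^ (5 * b ^ 2)) b.
Proof.
move=> W; set q := 4 * w; set n := #|W|.
have q_gt1 : 1 < q by rewrite /q; lia.
have small_le : #|[set X in indep_sets W | #|X| < b]| <= n.+1 ^ b.
  apply: leq_trans (card_small_subsets_le W b); apply/subset_leq_card/subsetP => X.
  by rewrite !inE => /andP[/andP[-> _] /ltnW].
apply: leq_trans small_le _; case: (leqP (q ^ (4 * b).+1) n) => [le_n|n_lt]; last first.
  apply: leq_trans (leq_wexp2r b n_lt) (leq_trans _ (leq_addr _ _)).
  by rewrite -expnM leq_exp2l // -mulnn; nia.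
apply: leq_trans (leq_addl _ _).
apply: leq_trans (_ : #|indep_sets_of_card W (2 * b)| <= _); last first.
  apply/subset_leq_card/subsetP => X; rewrite !inE => /andP[-> /eqP->].
  by rewrite leq_pmull.
have q_pow_gt0 : 0 < q ^ (2 * b) ^ 2 by rewrite expn_gt0 ltnW.
rewrite -(leq_pmul2l q_pow_gt0); apply: leq_trans (card_indep_sets_of_card_ge _).
  rewrite -/q -/n (_ : (2 * b) ^ 2 = 4 * b * b); last by rewrite -mulnn; lia.
  rewrite [q ^ _]expnM [n ^ _]expnM -expnMn leq_wexp2r // -mulnn.
  apply: leq_trans (leq_mul le_n (leqnn n)); rewrite expnSr -mulnA leq_mul //.
  rewrite ltn_Pmull //; apply: leq_trans le_n; rewrite expn_gt0; lia.
by apply: leq_trans le_n; rewrite leq_exp2l //; lia.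
Qed.

End BoundedCliques.

End IndependentSets.

Section Neighborhoods.
Variable G : sgraph.
Implicit Types (u v x : G).

Definition neighbors v := [set u | adj v u].

Definition neighbors2 v := neighbors v :|: \bigcup_(x in neighbors v) neighbors x.

Definition within3 v u := u \in \bigcup_(x in neighbors v) neighbors2 x.

Lemma neighbors_sym u v : (u \in neighbors v) = (v \in neighbors u).
Proof. by rewrite !inE adj_sym. Qed.

Lemma neighbors2_sym u v : u \in neighbors2 v -> v \in neighbors2 u.
Proof.
case/setUP=> [uv|/bigcupP[x xv ux]]; apply/setUP; first by left; rewrite neighbors_sym.
by right; apply/bigcupP; exists x; rewrite neighbors_sym.
Qed.

Lemma card_neighbors v : #|neighbors v| <= max_degree G.
Proof. exact: leq_bigmax. Qed.

Lemma card_bigcup_neighbors (F : G -> {set G}) v m n :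
  #|neighbors v| <= m -> (forall x, #|F x| <= n) ->
  #|\bigcup_(x in neighbors v) F x| <= m * n.
Proof.
move=> v_le F_le; apply: leq_trans (card_bigcup_le _ _) _.
apply: leq_trans (leq_sum _ (fun x _ => F_le x)) _.
by rewrite sum_nat_const leq_mul.
Qed.

Lemma card_within3 Delta v : max_degree G <= Delta ->
  #|[set u | within3 v u]| <= Delta * (Delta + Delta * Delta).
Proof.
move=> deg_le; have nbr_le x : #|neighbors x| <= Delta := leq_trans (card_neighbors x) deg_le.
rewrite cardsE; apply: card_bigcup_neighbors => // x.
apply: leq_trans (leq_card_setU _ _) _; rewrite leq_add //.
exact: card_bigcup_neighbors.
Qed.

End Neighborhoods.

Section Weight.
Local Open Scope ring_scope.
Variables M b : nat.
Hypotheses (M_gt0 : (0 < M)%N) (b_gt0 : (0 < b)%N).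

(* An exponential-moment weight for the size of a colour class: its product over the
   colours is small on average, but not small for a colouring in which few classes are
   empty and few have [b] elements or more. *)
Definition weight (n : nat) : rat :=
  2^-1 ^+ (n == 0)%N * (1 - M%:R^-1) ^+ (b <= n)%N.

Lemma weightE n : weight n = 1 - 2^-1 * (n == 0)%N%:R - M%:R^-1 * (b <= n)%N%:R.
Proof.
rewrite /weight; have [->|n_gt0] := posnP n; first by rewrite leqn0 eqn0Ngt b_gt0 /= expr1; lra.
by rewrite /= expr0; case: leqP => _ /=; rewrite ?expr1 ?expr0; lra.
Qed.

Lemma one_sub_inv_ge0 : 0 <= 1 - M%:R^-1 :> rat.
Proof. by rewrite subr_ge0 invf_le1 ?ltr0n // ler1n. Qed.

Lemma weight_ge0 n : 0 <= weight n.
Proof. by apply: mulr_ge0; apply: exprn_ge0; rewrite ?one_sub_inv_ge0. Qed.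

Lemma one_sub_inv_double_ge0 : 0 <= 1 - (2 * M%:R)^-1 :> rat.
Proof. by rewrite subr_ge0 -natrM invf_le1 ?ltr0n ?ler1n muln_gt0. Qed.

Lemma sum_weight_le (T : finType) (I : {set {set T}}) : set0 \in I ->
  (#|[set X in I | #|X| < b]| <= M + #|[set X in I | b <= #|X|]|)%N ->
  \sum_(X in I) weight #|X| <= (1 - (2 * M%:R)^-1) * #|I|%:R.
Proof.
move=> I0; set large := #|[set X in I | (b <= #|X|)%N]| => few_small.
have sum_empty : \sum_(X in I) (#|X| == 0)%N%:R = 1 :> rat.
  rewrite (bigD1 set0) //= cards0 eqxx big1 ?addr0 // => X /andP[_ X0].
  by rewrite cards_eq0 (negbTE X0).
have sum_large : \sum_(X in I) (b <= #|X|)%N%:R = large%:R :> rat.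
  by rewrite -natr_sum sum_bool_card.
have card_le : #|I|%:R <= M%:R + 2 * large%:R :> rat.
  rewrite -natrM -natrD ler_nat mul2n -addnn addnA.
  apply: leq_trans (leq_add few_small (leqnn large)); rewrite /large addnC.
  rewrite -(cardsID [set X : {set T} | b <= #|X|]%N I) -setIdE leq_add2l.
  by apply/eq_leq/eq_card => X; rewrite !inE -ltnNge andbC.
under eq_bigr do rewrite weightE.
rewrite !big_split /= !sumrN -!mulr_sumr sum_empty sum_large sumr_const.
have M_neq0 : M%:R != 0 :> rat by rewrite pnatr_eq0 -lt0n.
have -> : M%:R^-1 = 2 * (2 * M%:R)^-1 :> rat by field.
have inv_ge0 : 0 <= (2 * M%:R)^-1 :> rat by rewrite invr_ge0 mulr_ge0.
have := ler_wpM2l inv_ge0 card_le.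
have -> : (2 * M%:R)^-1 * (M%:R + 2 * large%:R) = 2^-1 + 2 * (2 * M%:R)^-1 * large%:R :> rat.
  by field.
lra.
Qed.

End Weight.

Section PartialColorings.
Variables (G : sgraph) (K : finType) (L : G -> {set K}).

Local Notation pcol := {ffun G -> option K}.
Implicit Types (f g : pcol) (u v x : G) (c d : K) (o : option K).
Implicit Types (D : {set pcol}) (N X : {set G}).

Definition list_colorable := exists f : G -> K, (forall v, f v \in L v) /\ proper_coloring f.

Definition available f v := [set c in L v | [forall u in neighbors v, f u != Some c]].

Definition partial_colorings : {set pcol} :=
  [set f : pcol | [forall u, forall c, (f u == Some c) ==> (c \in available f u)]].

Definition recolor X o f : pcol := [ffun u => if u \in X then o else f u].

Definition uncolored f := [set u | f u == None].

Lemma availableP f v c :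
  reflect (c \in L v /\ forall u, adj v u -> f u <> Some c) (c \in available f v).
Proof.
rewrite inE; apply: (iffP andP) => [[cL /forall_inP fresh]|[cL fresh]]; split=> //.
  by move=> u uv; apply/eqP/fresh; rewrite inE.
by apply/forall_inP => u /[!inE] /fresh/eqP.
Qed.

Lemma partial_coloringsP f :
  reflect (forall u c, f u = Some c -> c \in available f u) (f \in partial_colorings).
Proof.
rewrite inE; apply: (iffP forallP) => [pf u c fu|pf u].
  by have /forallP/(_ c)/implyP/(_ (introT eqP fu)) := pf u.
by apply/forallP => c; apply/implyP => /eqP/pf.
Qed.

Lemma partial_colorings0 : [ffun=> None] \in partial_colorings.
Proof. by apply/partial_coloringsP => u c; rewrite ffunE. Qed.

Lemma available0 v : available [ffun=> None] v = L v.
Proof.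
by apply/setP => c; apply/availableP/idP => [[]//|cL]; split=> // u _; rewrite ffunE.
Qed.

Lemma eq_in_available f g v : {in neighbors v, f =1 g} -> available f v = available g v.
Proof.
move=> eq_fg; apply/setP => c; rewrite !inE; congr (_ && _).
by apply: eq_forallb_in => u /eq_fg->.
Qed.

Lemma available_erase X f v : available f v \subset available (recolor X None f) v.
Proof.
apply/subsetP => c /availableP[cL fresh]; apply/availableP; split=> // u uv.
by rewrite ffunE; case: ifP => // _; exact: fresh.
Qed.

Lemma card_available_paint X c f v :
  #|available f v| <= #|available (recolor X (Some c) f) v| + ~~ [disjoint X & neighbors v].
Proof.
case: (boolP [disjoint X & neighbors v]) => [dis|_] /=.
  rewrite addn0 (@eq_in_available f (recolor X (Some c) f)) // => u uv.
  by rewrite ffunE (disjointFl dis uv).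
rewrite addn1 (cardsD1 c) -add1n leq_add ?leq_b1 //; apply/subset_leq_card/subsetP => d.
rewrite !inE => /andP[dc /andP[-> /forall_inP fresh]] /=.
apply/forall_inP => u uv; rewrite ffunE; case: ifP => _; last exact: fresh.
by apply: contraNneq dc => -[->].
Qed.

Lemma partial_coloring_erase X f :
  f \in partial_colorings -> recolor X None f \in partial_colorings.
Proof.
move=> /partial_coloringsP pf; apply/partial_coloringsP => u c.
by rewrite {1}ffunE; case: ifP => // _ /pf/(subsetP (available_erase X f u)).
Qed.

Lemma partial_coloring_paint X c f : f \in partial_colorings -> independent X ->
  {in X, forall u, c \in available f u} -> recolor X (Some c) f \in partial_colorings.
Proof.
move=> /partial_coloringsP pf /independentP indX cX; apply/partial_coloringsP => u d.
rewrite {1}ffunE; case: (boolP (u \in X)) => [uX [<-]|_ fu].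
  have /availableP[cL fresh] := cX u uX; apply/availableP; split=> // x ux.
  rewrite ffunE; case: (boolP (x \in X)) => [xX|_]; last exact: fresh.
  by have := indX u x uX xX; rewrite ux.
have /availableP[dL fresh] := pf u d fu; apply/availableP; split=> // x ux.
rewrite ffunE; case: (boolP (x \in X)) => [xX [cd]|_]; last exact: fresh.
by have /availableP[_ /(_ u)] := cX x xX; rewrite adj_sym fu cd => /(_ ux).
Qed.

Lemma greedy_list_colorable f : f \in partial_colorings ->
  {in uncolored f, forall v, #|neighbors v :&: uncolored f| < #|available f v|} ->
  list_colorable.
Proof.
have [m] := ubnP #|uncolored f|; elim: m f => // m IHm f card_f pf room.
have [colored|[u]] := set_0Vmem (uncolored f).
  have total v : exists c, f v = Some c.
    case fv: (f v) => [c|]; first by exists c.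
    by have := in_set0 v; rewrite -colored inE fv.
  have [g fg] := fin_all_exists total; exists g; split=> [v|u v uv guv].
    by have /availableP[] := partial_coloringsP _ pf _ _ (fg v).
  by have /availableP[_ /(_ _ uv)] := partial_coloringsP _ pf _ _ (fg u); rewrite guv.
move=> uf; have /card_gt0P[c cu] : 0 < #|available f u|.
  exact: leq_trans (room u uf).
set g := recolor [set u] (Some c) f.
have uncolored_g : uncolored g = uncolored f :\ u.
  by apply/setP => x; rewrite !inE ffunE inE; case: (x == u).
apply: (IHm g).
- by rewrite uncolored_g; move: card_f; rewrite (cardsD1 u) uf.
- by apply: partial_coloring_paint => // [|x /set1P->//]; exact: independent1.
move=> v; rewrite uncolored_g => /setD1P[_ vf].
have := leq_trans (room v vf) (card_available_paint [set u] c f v).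
rewrite disjoints1 negbK (cardsD1 u) inE uf andbT -/g setIDA addnC.
case: (u \in neighbors v); lia.
Qed.

Definition resamplable N D := D \subset partial_colorings /\
  forall f g, f \in D -> g \in partial_colorings -> {in ~: N, f =1 g} -> g \in D.

Lemma resamplable_recolor N D X o f : resamplable N D -> f \in D -> X \subset N ->
  recolor X o f \in partial_colorings -> recolor X o f \in D.
Proof.
move=> [_ closedD] fD /subsetP sXN pf; apply: closedD fD pf _ => u; rewrite inE => uN.
by rewrite ffunE; case: (boolP (u \in X)) => // /sXN; rewrite (negbTE uN).
Qed.

Definition flexible s f := [set u in uncolored f | s <= #|available f u|].

Lemma card_flexible_paint N D X u t f : resamplable N D -> u \in N -> u \in X -> f \in D ->
  X \subset flexible (#|X| + t) f ->
  t <= #|[set g in [set g in D | X :\ u \subset flexible (#|X :\ u| + t) g]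
           | recolor [set u] None g == f]|.
Proof.
move=> resD uN uX fD flexX.
have := subsetP flexX u uX; rewrite !inE => /andP[/eqP fu u_avail].
apply: leq_trans (leq_trans (leq_addl _ _) u_avail) _.
rewrite -(card_imset (f := fun c => recolor [set u] (Some c) f)); last first.
  by move=> c d /ffunP/(_ u); rewrite !ffunE set11 => -[].
have [/subsetP/(_ f fD) pf _] := resD.
apply/subset_leq_card/subsetP => _ /imsetP[c cu ->]; rewrite !inE; apply/andP; split; last first.
  by apply/eqP/ffunP => x; rewrite !ffunE inE; case: eqP => // ->.
apply/andP; split.
  apply: (resamplable_recolor resD) => //; first by rewrite sub1set.
  by apply: partial_coloring_paint => // [|x /set1P->//]; exact: independent1.
apply/subsetP => x /setD1P[xu xX]; have := subsetP flexX x xX.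
rewrite !inE ffunE inE (negbTE xu) => /andP[-> x_avail] /=.
have := leq_trans x_avail (card_available_paint [set u] c f x).
rewrite (cardsD1 u X) uX; case: (~~ _) => /=; lia.
Qed.

(* Colouring the vertices of [X] one at a time is injective and offers at least [t]
   choices at each step. *)
Lemma card_flexible_superset N D X t : resamplable N D -> X \subset N ->
  #|[set f in D | X \subset flexible (#|X| + t) f]| * t ^ #|X| <= #|D|.
Proof.
move=> resD; have [m] := ubnP #|X|; elim: m X => // m IHm X cardX sXN.
have [->|[u uX]] := set_0Vmem X.
  by rewrite cards0 muln1; apply/subset_leq_card/subsetP => f /[!inE] /andP[].
apply: leq_trans (IHm (X :\ u) _ _); last 1 first.
- exact: subset_trans (subsetDl _ _) sXN.
- rewrite {2}(cardsD1 u X) uX expnS mulnA leq_mul //.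
  apply: leq_trans (sum_card_fiber_le _ _ (recolor [set u] None)); rewrite -sum_nat_const.
  apply: leq_sum => f /[!inE] /andP[fD flexX].
  exact: card_flexible_paint resD (subsetP sXN u uX) uX fD flexX.
- by move: cardX; rewrite (cardsD1 u) uX.
Qed.

Lemma card_many_flexible N D m t : resamplable N D ->
  #|[set f in D | m <= #|N :&: flexible (m + t) f|]| * t ^ m <= 'C(#|N|, m) * #|D|.
Proof.
move=> resD; pose flexX X := [set f in D | X \subset flexible (#|X| + t) f].
have cover : [set f in D | m <= #|N :&: flexible (m + t) f|]
    \subset \bigcup_(X in [set X : {set G} | X \subset N & #|X| == m]) flexX X.
  apply/subsetP => f; rewrite inE -bin_gt0 -cards_draws => /andP[fD /card_gt0P[X]].
  rewrite inE subsetI => /andP[/andP[sXN sXf] /eqP cardX].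
  by apply/bigcupP; exists X; rewrite inE ?sXN ?fD ?cardX ?eqxx.
apply: leq_trans (leq_mul (subset_leq_card cover) (leqnn _)) _.
apply: leq_trans (leq_mul (card_bigcup_le _ _) (leqnn _)) _.
rewrite big_distrl /= -cards_draws -sum_nat_const; apply: leq_sum => X.
by rewrite inE => /andP[sXN /eqP <-]; exact: card_flexible_superset resD sXN.
Qed.

Definition color_class N c f := [set u in N | f u == Some c].

Definition erase N c f := recolor (color_class N c f) None f.

Definition erase_fiber N D c g := [set f in D | erase N c f == g].

Definition paintable N c g := [set u in N | (g u == None) && (c \in available g u)].

Lemma available_color_class f v :
  available f v = [set c in L v | color_class (neighbors v) c f == set0].
Proof.
apply/setP => c; rewrite !in_set; congr (_ && _).
apply/forall_inP/eqP => [fresh|unused u uv].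
  by apply/setP => u; rewrite in_set in_set0; apply/andP => -[/fresh/negP].
by apply/negP => fu; have := in_set0 u; rewrite -unused in_set uv fu.
Qed.

Lemma color_class_erase N c f : color_class N c (erase N c f) = set0.
Proof. by apply/setP => u; rewrite !inE ffunE !inE; case: (u \in N) => //=; case: ifP. Qed.

Lemma color_class_erase_neq N c d f : d != c ->
  color_class N d (erase N c f) = color_class N d f.
Proof.
move=> dc; apply/setP => u; rewrite !inE ffunE !inE; case: (u \in N) => //=.
by case: (f u =P Some c) => [->|//]; apply/esym; apply: contraNF dc => /eqP[->].
Qed.

Lemma eraseK N c f : recolor (color_class N c f) (Some c) (erase N c f) = f.
Proof.
apply/ffunP => u; rewrite !ffunE; case: (boolP (u \in _)) => [|//].
by rewrite inE => /andP[_ /eqP->].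
Qed.

Lemma color_class_paint N c g X : color_class N c g = set0 -> X \subset paintable N c g ->
  color_class N c (recolor X (Some c) g) = X.
Proof.
move=> /setP unused /subsetP sX; apply/setP => u; have := unused u; rewrite !inE ffunE.
by case: ifP => // /sX; rewrite !inE eqxx => /andP[->].
Qed.

Lemma erase_paint N c g X : color_class N c g = set0 -> X \subset paintable N c g ->
  erase N c (recolor X (Some c) g) = g.
Proof.
move=> unused sX; rewrite /erase color_class_paint //; apply/ffunP => u; rewrite !ffunE.
by case: (boolP (u \in X)) => [/(subsetP sX)|//]; rewrite inE => /and3P[_ /eqP->].
Qed.

Lemma color_class_indep_sets N c f : f \in partial_colorings ->
  color_class N c f \in indep_sets (paintable N c (erase N c f)).
Proof.
move=> /partial_coloringsP pf; rewrite inE; apply/andP; split.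
  apply/subsetP => u uc; move: (uc); rewrite !inE ffunE uc => /andP[-> /eqP fu] /=.
  by have := subsetP (available_erase (color_class N c f) f u) c (pf u c fu); rewrite inE.
apply/independentP => x y /[!inE] /andP[_ /eqP fx] /andP[_ /eqP fy]; apply/negP => xy.
by have /availableP[_ /(_ y xy)] := pf x c fx.
Qed.

(* Conditionally on everything but the vertices of [N] coloured [c], these form a
   uniform independent subset of [paintable]. *)
Lemma erase_fiberE N D c f0 : resamplable N D -> f0 \in D ->
  erase_fiber N D c (erase N c f0) =
  [set recolor X (Some c) (erase N c f0) | X in indep_sets (paintable N c (erase N c f0))].
Proof.
move=> resD f0D; have [/subsetP sD _] := resD; set g := erase N c f0.
have gD : g \in D.
  apply: (resamplable_recolor resD f0D); last exact/partial_coloring_erase/sD.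
  by rewrite /color_class setIdE subsetIl.
apply/setP => f; rewrite inE; apply/andP/imsetP => [[fD /eqP erase_f]|[X]].
  by exists (color_class N c f); rewrite -erase_f ?eraseK ?color_class_indep_sets ?sD.
rewrite inE => /andP[sX indX] ->; split; last by rewrite erase_paint ?color_class_erase.
apply: (resamplable_recolor resD gD).
  by apply: subset_trans sX _; rewrite /paintable setIdE subsetIl.
by apply: partial_coloring_paint (sD g gD) indX _ => u /(subsetP sX) /[!inE] /and3P[].
Qed.

Definition bad t v f :=
  (#|available f v| < 2 * t) || (t <= #|neighbors v :&: flexible (2 * t) f|).

Lemma eq_in_bad t v f g : {in neighbors2 v, f =1 g} -> bad t v f = bad t v g.
Proof.
move=> eq_fg; have sub1 : {subset neighbors v <= neighbors2 v}.
  by move=> u uv; rewrite inE uv.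
rewrite /bad (@eq_in_available f g v); last by move=> u /sub1/eq_fg.
congr (_ || (_ <= #|pred_of_set _|)); apply/setP => u; rewrite !in_setI.
case: (boolP (u \in neighbors v)) => //= uv; rewrite !inE eq_fg ?sub1 //.
rewrite (@eq_in_available f g u) // => x xu; apply: eq_fg.
by apply/setUP; right; apply/bigcupP; exists u.
Qed.

Lemma resamplable_avoiding t v (S : {set G}) : {in S, forall u, ~~ within3 v u} ->
  resamplable (neighbors v) (avoiding partial_colorings (bad t) S).
Proof.
move=> far; split=> [|f g]; first by apply/subsetP => f; rewrite inE => /andP[].
rewrite !inE => /andP[_ /forall_inP goodf] -> eq_fg /=.
apply/forall_inP => u uS; rewrite -(@eq_in_bad _ _ f g) ?goodf // => x xu; apply: eq_fg.
rewrite inE; apply: contra (far u uS) => xv.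
by apply/bigcupP; exists x => //; exact: neighbors2_sym.
Qed.

Lemma list_colorable_avoiding t f : f \in partial_colorings -> (forall v, ~~ bad t v f) ->
  list_colorable.
Proof.
move=> pf good; apply: (greedy_list_colorable pf) => v _.
have := good v; rewrite negb_or -leqNgt -ltnNge => /andP[v_avail].
rewrite (_ : flexible _ f = uncolored f); first by lia.
apply/setP => u; rewrite inE; have := good u; rewrite negb_or -leqNgt => /andP[-> _].
exact: andbT.
Qed.

Section FewSmallIndepSets.
Variables M b : nat.
Hypotheses (M_gt1 : 1 < M) (b_gt0 : 0 < b) (few_small : few_small_indep_sets G M b).
Let M_gt0 : 0 < M := ltnW M_gt1.

Section ColorClassWeights.
Local Open Scope ring_scope.

Lemma sum_weight_erase_fiber N D c f0 (F := erase_fiber N D c (erase N c f0)) :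
  resamplable N D -> f0 \in D ->
  \sum_(f in F) weight M b #|color_class N c f| <= (1 - (2 * M%:R)^-1) * #|F|%:R.
Proof.
move=> resD f0D; rewrite /F erase_fiberE //.
set g := erase N c f0; set W := paintable N c g.
have classK : {in indep_sets W, forall X, color_class N c (recolor X (Some c) g) = X}.
  by move=> X /[!inE] /andP[sX _]; rewrite color_class_paint // color_class_erase.
have paint_inj : {in indep_sets W &, injective (fun X => recolor X (Some c) g)}.
  by move=> X Y IX IY eqXY; rewrite -(classK X IX) eqXY classK.
rewrite big_imset //= card_in_imset //.
rewrite (eq_bigr (fun X => weight M b #|X|)); last by move=> X /classK->.
by apply: sum_weight_le => //; exact: set0_indep_sets.
Qed.

Lemma sum_weight_color_class N D c (P : pcol -> rat) : resamplable N D ->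
  (forall f, 0 <= P f) -> (forall f, P (erase N c f) = P f) ->
  \sum_(f in D) weight M b #|color_class N c f| * P f
    <= (1 - (2 * M%:R)^-1) * \sum_(f in D) P f.
Proof.
move=> resD P_ge0 P_erase.
rewrite (partition_big (erase N c) predT) //= [X in _ * X](partition_big (erase N c) predT) //=.
rewrite mulr_sumr; apply: ler_sum => g _.
have sum_fiber (F : pcol -> rat) :
    \sum_(f in D | erase N c f == g) F f * P f = (\sum_(f in erase_fiber N D c g) F f) * P g.
  rewrite mulr_suml; apply: eq_big => [f|f /andP[_ /eqP<-]]; first by rewrite inE.
  by rewrite P_erase.
have -> : \sum_(f in D | erase N c f == g) P f = #|erase_fiber N D c g|%:R * P g.
  by rewrite -sum1_card natr_sum -sum_fiber; apply: eq_bigr => f _; rewrite mul1r.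
rewrite sum_fiber mulrA ler_wpM2r //.
have [->|[f0]] := set_0Vmem (erase_fiber N D c g); first by rewrite big_set0 cards0 mulr0.
by rewrite inE => /andP[f0D /eqP<-]; exact: sum_weight_erase_fiber.
Qed.

Lemma sum_prod_weight N D (S : {set K}) : resamplable N D ->
  \sum_(f in D) \prod_(c in S) weight M b #|color_class N c f|
    <= (1 - (2 * M%:R)^-1) ^+ #|S| * #|D|%:R.
Proof.
move=> resD; under eq_bigr do rewrite -big_enum.
rewrite cardE; elim: (enum S) (enum_uniq S) => [_|c s IHs /= /andP[cs uniq_s]].
  by rewrite expr0 mul1r; under eq_bigr do rewrite big_nil; rewrite sumr_const.
under eq_bigr do rewrite big_cons.
rewrite exprS -mulrA; apply: le_trans (ler_wpM2l _ (IHs uniq_s)); last first.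
  exact: one_sub_inv_double_ge0.
apply: sum_weight_color_class => // f; first by apply: prodr_ge0 => d _; exact: weight_ge0.
apply: eq_big_seq => d ds; rewrite color_class_erase_neq //.
by apply: contraNneq cs => <-.
Qed.

Lemma card_large_color_classes N f :
  (#|[set c | b <= #|color_class N c f|]| <= #|N| %/ b)%N.
Proof.
rewrite leq_divRL // -sum_nat_const.
set large := [set c | _].
apply: leq_trans (sum_card_fiber_le N [set Some c | c in large] f).
rewrite big_imset /=; last by move=> c d _ _ [].
by apply: leq_sum => c; rewrite inE.
Qed.

Lemma card_few_available v D a : resamplable (neighbors v) D ->
  #|[set f in D | (#|available f v| < a)%N]|%:R
      * (2^-1 ^+ a * (1 - M%:R^-1) ^+ (#|neighbors v| %/ b))
    <= (1 - (2 * M%:R)^-1) ^+ #|L v| * #|D|%:R :> rat.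
Proof.
move=> resD; apply: le_trans (sum_prod_weight (L v) resD).
set few := [set f in D | _]; rewrite [leRHS](big_setID few) /= -[leLHS]addr0.
apply: lerD; last by apply: sumr_ge0 => f _; apply: prodr_ge0 => c _; exact: weight_ge0.
rewrite (setIidPr _); last by apply/subsetP => f; rewrite inE => /andP[].
rewrite mulr_natl -sumr_const; apply: ler_sum => f /[!inE] /andP[_ few_f].
rewrite big_split /= !prodrXr !sum_bool_card.
apply: ler_pM; rewrite ?exprn_ge0 ?one_sub_inv_ge0 //.
  apply: ler_wiXn2l => //; apply: leq_trans (ltnW few_f).
  rewrite available_color_class; apply/eq_leq/eq_card => c.
  by rewrite !inE cards_eq0.
apply: ler_wiXn2l; rewrite ?one_sub_inv_ge0 ?gerBl ?invr_ge0 //.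
apply: leq_trans (card_large_color_classes (neighbors v) f); apply/subset_leq_card/subsetP => c.
by rewrite !inE => /andP[].
Qed.

End ColorClassWeights.

Variables (Delta k t : nat).
Hypotheses (deg_le : max_degree G <= Delta) (list_ge : forall v, k <= #|L v|).
Hypothesis t_large : 'C(Delta, t) * (2 * Delta ^ 4) <= t ^ t.
Hypothesis k_large : ((2 * Delta ^ 4)%:R * (1 - (2 * M%:R)^-1) ^+ k
  <= 2^-1 ^+ (2 * t) * (1 - M%:R^-1) ^+ (Delta %/ b) :> rat)%R.

Lemma card_few_available_le v D : resamplable (neighbors v) D ->
  2 * Delta ^ 4 * #|[set f in D | #|available f v| < 2 * t]| <= #|D|.
Proof.
move=> resD; pose q := (2^-1 ^+ (2 * t) * (1 - M%:R^-1) ^+ (Delta %/ b) : rat)%R.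
have base_gt0 : (0 < 1 - M%:R^-1 :> rat)%R.
  by rewrite subr_gt0 invf_lt1 ?ltr0n ?ltr1n.
have q_gt0 : (0 < q)%R by apply: mulr_gt0; apply: exprn_gt0; rewrite // invr_gt0.
rewrite -(ler_nat rat) -(ler_pM2r q_gt0) natrM -mulrA.
have nbr_le : (#|neighbors v| %/ b <= Delta %/ b).
  exact/leq_div2r/(leq_trans (card_neighbors v)).
have inv_ge0 : (0 <= M%:R^-1 :> rat)%R by rewrite invr_ge0.
have few_le := card_few_available (2 * t) resD.
apply: le_trans (_ : (2 * Delta ^ 4)%:R * ((1 - (2 * M%:R)^-1) ^+ #|L v| * #|D|%:R) <= _)%R.
  apply: ler_wpM2l => //; apply: le_trans few_le; apply: ler_wpM2l => //.
  by apply: ler_wpM2l; [rewrite exprn_ge0 ?invr_ge0 | rewrite ler_wiXn2l ?gerBl // ltW].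
rewrite mulrA mulrC ler_wpM2l //; apply: le_trans k_large; apply: ler_wpM2l => //.
by rewrite ler_wiXn2l ?gerBl ?one_sub_inv_double_ge0 // invr_ge0 mulr_ge0.
Qed.

Lemma card_many_flexible_le v D : resamplable (neighbors v) D ->
  2 * Delta ^ 4 * #|[set f in D | t <= #|neighbors v :&: flexible (2 * t) f|]| <= #|D|.
Proof.
move=> resD; have := card_many_flexible t t resD; rewrite addnn -mul2n.
set many := [set f in D | _] => many_le.
have pow_gt0 : 0 < t ^ t by rewrite expn_gt0 lt0n orNb.
rewrite -(leq_pmul2r pow_gt0) -mulnA; apply: leq_trans (leq_mul (leqnn _) many_le) _.
rewrite mulnA [leqRHS]mulnC leq_mul // (leq_trans _ t_large) // [leqRHS]mulnC leq_mul //.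
by rewrite leq_bin2l // (leq_trans (card_neighbors v)).
Qed.

Lemma card_bad_le v D : resamplable (neighbors v) D ->
  Delta ^ 4 * #|[set f in D | bad t v f]| <= #|D|.
Proof.
move=> resD; have := card_few_available_le resD; have := card_many_flexible_le resD.
set many := [set f in D | _]; set few := [set f in D | #|_| < _].
have : #|[set f in D | bad t v f]| <= #|few| + #|many|.
  apply: leq_trans (leq_card_setU _ _); apply/subset_leq_card/subsetP => f.
  by rewrite !inE /bad => /andP[->].
nia.
Qed.

Lemma list_colorable_few_small_indep_sets : 8 <= Delta -> list_colorable.
Proof.
move=> Delta_ge8.
have bad_far v (S : {set G}) : {in S, forall u, ~~ within3 v u} ->
    Delta ^ 4 * #|[set f in avoiding partial_colorings (bad t) S | bad t v f]|
      <= #|avoiding partial_colorings (bad t) S|.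
  by move=> far; apply/card_bad_le/resamplable_avoiding.
have [|||f pf good] := lopsided_local_lemma bad_far (fun v => card_within3 v deg_le).
- have := Delta_ge8; clear; rewrite !expnS expn0; nia.
- by apply: leq_trans (_ : 8 ^ 4 <= _); rewrite // leq_wexp2r.
- by apply/card_gt0P; exists [ffun=> None]; exact: partial_colorings0.
exact: list_colorable_avoiding pf good.
Qed.

End FewSmallIndepSets.

End PartialColorings.

Lemma choosable_few_small_indep_sets (G : sgraph) (Delta M b : nat) :
  4 <= M -> 0 < b <= M -> M ^ 20 <= Delta -> max_degree G <= Delta ->
  few_small_indep_sets G M b -> choosable G (8 * Delta %/ b).
Proof.
move=> M_ge4 /andP[b_gt0 b_leM] M20_le deg_le few_small K L list_ge.
have M_gt1 : 1 < M by apply: leq_trans M_ge4.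
pose t := Delta %/ (2 * M ^ 2).
have cube_le : Delta ^ 3 <= t ^ 4 by exact: cube_le_expn4_div.
have M15_le : M ^ 15 <= t.
  rewrite -(@leq_exp2r _ _ 4) // -expnM (leq_trans _ cube_le) // -[15 * 4]/(20 * 3) expnM.
  exact: leq_wexp2r.
have t_ge : 48 <= t.
  apply: leq_trans M15_le; apply: leq_trans (leq_pexp2l (ltnW M_gt1) (_ : 3 <= 15)) => //.
  by apply: leq_trans (leq_wexp2r 3 M_ge4).
have Delta_ge8 : 8 <= Delta.
  apply: leq_trans M20_le; apply: leq_trans (leq_pexp2l (ltnW M_gt1) (_ : 2 <= 20)) => //.
  by apply: leq_trans (leq_wexp2r 2 M_ge4).
have Delta_gt0 : 0 < Delta by apply: leq_trans Delta_ge8.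
have sqr_ge : Delta <= t ^ 2.
  by rewrite -(@leq_exp2r _ _ 2) // -expnM (leq_trans _ cube_le) // leq_pexp2l.
apply: (list_colorable_few_small_indep_sets M_gt1 b_gt0 few_small deg_le list_ge (t := t)) => //.
  by apply: bin_mul_expn4_le => //; [exact: leq_trans Delta_ge8 | exact: leq_trans t_ge].
apply: expn4_mul_exprn_one_sub_inv_double_le => //.
- rewrite leq_divRL //; apply: leq_trans (leq_mul (leqnn _) b_leM) _.
  rewrite (_ : _ * M = 8 * (t * (2 * M ^ 2))); last by rewrite -mulnn; lia.
  by rewrite leq_mul // leq_divM.
- by rewrite leq_divRL // -mulnA leq_mul // leq_divM.
- exact: leq_trans t_ge.
apply: leq_trans (leq_wexp2r 4 sqr_ge) _.
by rewrite -expnM expn8_le_exp2.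
Qed.

Lemma choosable_degree (G : sgraph) : choosable G (max_degree G).+1.
Proof.
move=> K L list_ge; apply: (greedy_list_colorable (partial_colorings0 L)) => v _.
rewrite available0; apply: leq_trans (list_ge v); rewrite ltnS.
apply: leq_trans (card_neighbors v); apply/subset_leq_card; exact: subsetIl.
Qed.

Lemma list_chromatic_number_le (G : sgraph) k : choosable G k -> list_chromatic_number G <= k.
Proof.
by move=> chG; rewrite /list_chromatic_number; case: ex_minnP => m _; apply; apply/asboolP.
Qed.

Lemma list_chromatic_number_bounded_cliques (G : sgraph) (Delta w b : nat) :
  1 < w -> w ^ (300 * b ^ 2) <= Delta -> max_degree G <= Delta ->
  (forall A : {set G}, is_clique A -> #|A| <= w) ->
  list_chromatic_number G * b.+1 <= 16 * Delta.
Proof.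
move=> w_gt1 le_Delta deg_le clique_le; have w_gt0 := ltnW w_gt1.
have [b0|b_gt0] := posnP b.
  rewrite b0 muln1; apply: leq_trans (list_chromatic_number_le (@choosable_degree G)) _.
  by move: le_Delta; rewrite b0 muln0 expn0; clear -deg_le; lia.
set M := (4 * w) ^ (5 * b ^ 2); have base_gt1 : 1 < 4 * w by rewrite (leq_trans w_gt1) ?leq_pmull.
have b_le : b <= 5 * b ^ 2 by rewrite -mulnn mulnA leq_pmull // muln_gt0.
have M_ge4 : 4 <= M.
  apply: (@leq_trans (4 ^ (5 * b ^ 2))); last by rewrite leq_wexp2r // leq_pmulr.
  by rewrite -{1}[4]expn1 leq_exp2l // (leq_trans b_gt0).
have b_itv : 0 < b <= M.
  by rewrite b_gt0 (leq_trans (ltnW (ltn_expl b base_gt1))) // leq_exp2l.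
have M20_le : M ^ 20 <= Delta.
  apply: leq_trans le_Delta; rewrite -expnM mulnAC -[300 * _](mulnA 3 100) (expnM w 3).
  by rewrite leq_wexp2r // [leqRHS]expnSr leq_mul // (leq_wexp2r 2 w_gt1).
have few_small := few_small_indep_sets_bounded_cliques clique_le w_gt0 b.
have chooseG := choosable_few_small_indep_sets M_ge4 b_itv M20_le deg_le few_small.
have := list_chromatic_number_le chooseG; rewrite leq_divRL // => chi_le.
rewrite -[16]/(2 * 8) -mulnA; apply: leq_trans (leq_mul (leqnn 2) chi_le).
by rewrite mulnCA leq_mul // mul2n -addnn -addn1 leq_add2l.
Qed.

Local Open Scope ring_scope.

Theorem theorem1p6 (R : realType) :
  exists C : R, 0 < C /\
    forall Delta omega : nat, (2 <= Delta)%N -> (2 <= omega)%N ->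
    forall G : sgraph, (max_degree G <= Delta)%N ->
      (forall A : {set G}, is_clique A -> (#|A| <= omega)%N) ->
      (list_chromatic_number G)%:R
        <= C * Delta%:R * Num.sqrt (ln (omega%:R : R) / ln (Delta%:R : R)).
Proof.
exists (18 * 16); split=> [|Delta w Delta_ge2 w_ge2 G deg_le clique_le].
  by rewrite mulr_gt0.
have [Delta_gt0 w_gt0] : (0 < Delta)%N /\ (0 < w)%N by split; apply: ltnW.
have [b /andP[le_Delta Delta_lt]] := ex_max_sqr_exponent w_ge2 (isT : 0 < 300)%N Delta_gt0.
have chi_le := list_chromatic_number_bounded_cliques w_ge2 le_Delta deg_le clique_le.
set x := ln _ / ln _.
have sqrt_ge : 1 <= (18 * b.+1)%:R * Num.sqrt x.
  apply: le1_mul_sqrt_div; rewrite ?ler0n ?ln_gt0 ?ltr1n //.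
  apply: le_trans (ln_natr_le R Delta_gt0 w_gt0 (ltnW Delta_lt)) _.
  by rewrite -natrX ler_wpM2r ?ln_ge0 ?ler1n // ler_nat expnMn leq_mul.
apply: le_trans (_ : (list_chromatic_number G)%:R * ((18 * b.+1)%:R * Num.sqrt x) <= _).
  by rewrite -[leLHS]mulr1 ler_wpM2l.
rewrite mulrA ler_wpM2r ?sqrtr_ge0 // -!natrM ler_nat mulnCA -mulnA.
by rewrite leq_mul.
Qed.
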